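(* Let $(M,\omega)$ be a symplectic manifold of dimension $2n$ and $U\subset M$ an open convex set. Let $\phi:U\times U\to U$ be a consistent implicit map, with associated local diffeomorphisms $\psi_1,\psi_2$, and let $\psi=\psi_2^{-1}\circ\psi_1$ be its consistency map. Then $\phi$ interleaves a symplectic map if $$(T\psi_1)^{-T}\,J\,(T\psi_1)^{-1}=(T\psi_2)^{-T}\,J\,(T\psi_2)^{-1},$$ where $T\psi_1$ and $T\psi_2$ are the tangent maps and $(\cdot)^{-T}=\left((\cdot)^{-1}\right)^T$ is the transpose of the inverse map. Moreover, if $\psi_1$ and $\psi_2$ are symplectic, then $$(T\psi_1)^T\,J\,T\psi_1=(T\psi_2)^T\,J\,T\psi_2 .$$
   Context: Let $\phi:U\times U\to U$ be an implicit map such that $z_{k+1}=\phi(z_k,z_{k+1})$. The map $\phi$ is called consistent if there exist a point $\bar z\in U$ (the consistency point) and two local diffeomorphisms $\psi_1,\psi_2:U\to U$ with $\bar z=\psi_1(z_k)$ and $\bar z=\psi_2(z_{k+1})$ such that: (1) it is possible to rewrite $\phi$ in the form $\phi(z_k,z_{k+1})=\psi_2^{-1}(\bar z)=z_{k+1}$; and (2) $\lim_{z_{k+1}\to z_k}\psi_i=\mathrm{Id}$ for $i=1,2$. The consistency map of $\phi$ is the local diffeomorphism $\psi=\psi_2^{-1}\circ\psi_1:U\to U$. A consistent implicit map $\phi$ interleaves a symplectic map if its consistency map is symplectic, i.e. $\psi^*\omega=\omega$. The tangent maps are $T\psi_1|_{z_k}:T_{z_k}U\to T_{\bar z}U$ and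 $T\psi_2|_{z_{k+1}}:T_{z_{k+1}}U\to T_{\bar z}U$, and the first equality is read on $T_{\bar z}U$. $J$ denotes the canonical complex structure on the tangent spaces $T_zM\cong\mathbb R^{2n}$, given by the matrix $J=\begin{pmatrix}0_n&-I_n\\ I_n&0_n\end{pmatrix}$. *)

(* Defs.v *)
(* MathComp-Analysis, over an arbitrary [R : realType]. *)
From mathcomp Require Import all_boot all_order all_algebra.
From mathcomp Require Import all_classical all_reals all_analysis.
Import Order.TTheory GRing.Theory Num.Theory.
Import numFieldNormedType.Exports.

Set Implicit Arguments.
Unset Strict Implicit.
Unset Printing Implicit Defensive.

Local Open Scope classical_set_scope.
Local Open Scope ring_scope.

(* In finite dimension, f is C^(k+1) on an open set iff it is differentiable
   there with all its directional derivatives C^k; only used on open sets. *)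
Fixpoint Ck (R : realType) (V W : normedModType R) (k : nat) (A : set V)
    (f : V -> W) : Prop :=
  match k with
  | 0 => forall x, A x -> {for x, continuous f}
  | k'.+1 => (forall x, A x -> differentiable f x)
             /\ forall v, Ck k' A (fun x => 'd f x v)
  end.

Definition smooth (R : realType) (V W : normedModType R) (A : set V)
  (f : V -> W) : Prop := forall k, Ck k A f.

(* [cmap] is meaningful on [cdom] and [cinv] on [cmap @` cdom] only. *)
Record chart (R : realType) (d : nat) (M : topologicalType) := Chart {
  cdom : set M ;
  cmap :> M -> 'rV[R]_d ;
  cinv : 'rV[R]_d -> M ;
  cdom_open : open cdom ;
  cimg_open : open (cmap @` cdom) ;
  cmapK : forall z, cdom z -> cinv (cmap z) = z ;
  cmap_continuous : forall z, cdom z -> {for z, continuous cmap} ;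
  cinv_continuous : forall x, (cmap @` cdom) x -> {for x, continuous cinv}
}.

Definition compatible (R : realType) (d : nat) (M : topologicalType)
    (c c' : chart R d M) : Prop :=
  smooth (c @` (cdom c `&` cdom c')) (c' \o cinv c)
  /\ smooth (c' @` (cdom c `&` cdom c')) (c \o cinv c').

(* Matrix, acting on column vectors, of T_z f in the coordinates of c at z and
   of c' at f z; [jacobian] acts on row vectors, hence the transpose. *)
Definition coord_tangent (R : realType) (d : nat) (M : topologicalType)
    (c c' : chart R d M) (f : M -> M) (z : M) : 'M[R]_d :=
  (jacobian (c' \o f \o cinv c) (c z))^T.

(* [atlas] is the maximal atlas of the smooth structure. The 2-form is given by
   its components: omega(u, v) = u^T (omega c (c z)) v for u, v in T_z M written
   as columns in the coordinates of c. [omega_closed] is d omega = 0. *)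
Record symplectic_manifold (R : realType) (n : nat) := SymplecticManifold {
  points :> topologicalType ;
  points_hausdorff : hausdorff_space points ;
  points_second_countable : @second_countable points ;
  atlas : set (chart R (n + n) points) ;
  atlas_cover : forall z, exists2 c, atlas c & cdom c z ;
  atlas_compatible : forall c c', atlas c -> atlas c' -> compatible c c' ;
  atlas_maximal : forall c,
    (forall c', atlas c' -> compatible c c') -> atlas c ;
  omega : chart R (n + n) points -> 'rV[R]_(n + n) -> 'M[R]_(n + n) ;
  omega_smooth : forall c i j, atlas c ->
    smooth (c @` cdom c) (fun x => omega c x i j : R^o) ;
  omega_change : forall c c' z, atlas c -> atlas c' -> cdom c z -> cdom c' z ->
    (coord_tangent c c' idfun z)^T *m omega c' (c' z)
      *m coord_tangent c c' idfun z = omega c (c z) ;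
  omega_skew : forall c z, atlas c -> cdom c z ->
    (omega c (c z))^T = - omega c (c z) ;
  omega_nondegenerate : forall c z, atlas c -> cdom c z ->
    omega c (c z) \in unitmx ;
  omega_closed : forall c z (i j k : 'I_(n + n)), atlas c -> cdom c z ->
    'D_(delta_mx 0 i) (fun x => omega c x j k : R^o) (c z)
    + 'D_(delta_mx 0 j) (fun x => omega c x k i : R^o) (c z)
    + 'D_(delta_mx 0 k) (fun x => omega c x i j : R^o) (c z) = 0
}.

Section Maps.
Variables (R : realType) (n : nat) (M : symplectic_manifold R n).
Implicit Types (U : set M) (f : M -> M) (c : chart R (n + n) M) (z : M).

(* Maps are total functions on M; only their values on the open set U matter. *)
Definition smooth_on U f : Prop :=
  (forall z, U z -> {for z, continuous f})
  /\ forall c c', atlas c -> atlas c' ->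
       smooth (c @` (U `&` cdom c `&` f @^-1` cdom c')) (c' \o f \o cinv c).

Definition local_diffeo U f : Prop :=
  set_fun U U f
  /\ forall z, U z -> exists V : set M, exists g : M -> M,
       [/\ open V, V z & V `<=` U]
       /\ [/\ open (f @` V), smooth_on V f, smooth_on (f @` V) g
            & forall w, V w -> g (f w) = w].

(* f^* omega = omega on U *)
Definition symplectic_on U f : Prop :=
  forall z c c', U z -> atlas c -> atlas c' -> cdom c z -> cdom c' (f z) ->
    (coord_tangent c c' f z)^T *m omega c' (c' (f z)) *m coord_tangent c c' f z
    = omega c (c z).

Definition implicit_step U (phi : M * M -> M) (z z' : M) : Prop :=
  [/\ U z, U z' & z' = phi (z, z')].

(* [psi2V] is the inverse psi_2^-1 of the local diffeomorphism psi_2: as psi_2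
   need not be injective on U, it is a continuous branch of the inverse over
   psi_1(U), the set of consistency points (if psi_2 is injective there is only
   one choice, and continuity is automatic). *)
Record consistency U (phi : M * M -> M) := Consistency {
  psi1 : M -> M ;
  psi2 : M -> M ;
  psi2V : M -> M ;
  psi1_local_diffeo : local_diffeo U psi1 ;
  psi2_local_diffeo : local_diffeo U psi2 ;
  psi2V_fun : set_fun (psi1 @` U) U psi2V ;
  psi2VK : forall zbar, (psi1 @` U) zbar -> psi2 (psi2V zbar) = zbar ;
  psi2V_continuous : forall zbar, (psi1 @` U) zbar ->
    {for zbar, continuous psi2V} ;
  (* condition (1): the implicit equation is rewritten as z' = psi_2^-1(zbar),
     where zbar is the consistency point of (z, z') *)
  consistency_point : forall z z', U z -> U z' ->
    (z' = phi (z, z') <->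
     exists2 zbar, U zbar
       & [/\ zbar = psi1 z, zbar = psi2 z' & z' = psi2V zbar]) ;
  (* condition (2): along the steps (z, z') of phi, psi_1(z) and psi_2(z') tend
     to w when z and z' both tend to w *)
  psi1_to_id : forall w, U w ->
    (fun p : M * M => psi1 p.1)
      @ within [set p | implicit_step U phi p.1 p.2] (nbhs (w, w)) --> w ;
  psi2_to_id : forall w, U w ->
    (fun p : M * M => psi2 p.2)
      @ within [set p | implicit_step U phi p.1 p.2] (nbhs (w, w)) --> w
}.

Definition consistency_map U phi (K : consistency U phi) : M -> M :=
  psi2V K \o psi1 K.

Definition interleaves_symplectic_map U phi (K : consistency U phi) : Prop :=
  symplectic_on U (consistency_map K).

End Maps.

Definition Jmx (R : realType) (n : nat) : 'M[R]_(n + n) :=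
  block_mx 0 (- 1%:M) 1%:M 0.

(* An identification T_z M ~ R^(2n), for z in U, under which omega is the
   canonical form compatible with J, omega(u, J v) = <u, v>, i.e. has matrix
   J^T. It is given by the columns of e z, which are the coordinates in c of a
   symplectic basis of T_z M; in Darboux coordinates one may take e z = 1. *)
Definition symplectic_frame (R : realType) (n : nat)
    (M : symplectic_manifold R n) (c : chart R (n + n) M) (U : set M)
    (e : M -> 'M[R]_(n + n)) : Prop :=
  forall z, U z -> (e z)^T *m omega c (c z) *m e z = (Jmx R n)^T.

(* The matrix of T_z f under the identifications of T_z M and T_(f z) M. *)
Definition tangent_mx (R : realType) (n : nat) (M : symplectic_manifold R n)
    (c : chart R (n + n) M) (e : M -> 'M[R]_(n + n)) (f : M -> M) (z : M) :
    'M[R]_(n + n) :=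
  invmx (e (f z)) *m coord_tangent c c f z *m e z.

(* Main.v *)
(* Near a point [z], continuity of the branch [psi2V] makes the consistency map
   [psi] equal to [g2 \o psi1], with [g2] the local inverse of [psi2] at [psi z];
   hence [T psi = (T psi2)^-1 (T psi1)], and the hypothesis on the steps
   [(z, psi z)] says exactly that this matrix preserves J. For the second part,
   both sides equal J when [psi1] and [psi2] are symplectic. *)
Require Import Defs.
From mathcomp Require Import all_boot all_order all_algebra.
From mathcomp Require Import all_classical all_reals all_analysis.
Import numFieldNormedType.Exports.
Import GRing.Theory.
Local Open Scope classical_set_scope.
Local Open Scope ring_scope.

Set Implicit Arguments.
Unset Strict Implicit.
Unset Printing Implicit Defensive.

(** * Locality and chain rule for differentials and Jacobians *)

(** The first-order expansion of [g] at [x] is also one of [f], and differentials are unique.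
    Locality matters because charts and their inverses cancel only on their domains. *)
Lemma near_eq_diff (R : numFieldType) (V W : normedModType R) (f g : V -> W)
    (x : V) :
  (\near x, f x = g x) -> differentiable g x ->
  differentiable f x /\ 'd f x = 'd g x :> (V -> W).
Proof.
move=> fg dg.
have dgc : continuous ('d g x) by exact: diff_continuous.
have fE : f \o shift x = cst (f x) + 'd g x +o_ 0 id.
  apply/eqaddoP => eps eps0.
  have /eqaddoP/(_ eps eps0) := diff_locally dg.
  apply: filter_app.
  have : \forall h \near 0, f (h + x) = g (h + x).
    by move: fg; rewrite (near_shift 0 x) subr0 /=.
  apply: filterS => h fgh.
  (* Unfolding the sum of functions exposes the values; [f] and [g] agree at [h + x] and at [x]
     itself. *)
  by rewrite [in X in _ -> X]/GRing.add /= fgh (nbhs_singleton fg).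
have dfE : 'd f x = 'd g x :> (V -> W) := diff_unique dgc fE.
by split; [apply/diff_locallyP; rewrite dfE | rewrite dfE].
Qed.

Lemma near_eq_jacobian (R : numFieldType) (m n : nat)
    (f g : 'rV[R]_m -> 'rV[R]_n) (x : 'rV[R]_m) :
  (\near x, f x = g x) -> differentiable g x ->
  differentiable f x /\ jacobian f x = jacobian g x.
Proof.
move=> fg dg; have [df dE] := near_eq_diff fg dg; split; first exact: df.
apply/row_matrixP => i.
rewrite [LHS]rowE [RHS]rowE [LHS]mul_rV_lin1 [RHS]mul_rV_lin1.
exact: (congr1 (fun h => h _) dE).
Qed.

Lemma jacobian_comp (R : numFieldType) (m n p : nat) (f : 'rV[R]_m -> 'rV[R]_n)
    (g : 'rV[R]_n -> 'rV[R]_p) (x : 'rV[R]_m) :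
  differentiable f x -> differentiable g (f x) ->
  jacobian (g \o f) x = jacobian f x *m jacobian g (f x).
Proof.
move=> df dg; apply/row_matrixP => i.
rewrite [LHS]rowE [RHS]rowE mulmxA [LHS]mul_rV_lin1.
rewrite [X in _ = X *m _]mul_rV_lin1 [RHS]mul_rV_lin1.
exact: (congr1 (fun h => h _) (diff_comp df dg)).
Qed.

Lemma jacobian_id (R : numFieldType) (m : nat) (x : 'rV[R]_m) :
  jacobian (@idfun 'rV[R]_m) x = 1%:M.
Proof.
apply/row_matrixP => i; rewrite [LHS]rowE [RHS]rowE mulmx1 [LHS]mul_rV_lin1.
exact: (congr1 (fun h => h _) (diff_val (is_diff_def := is_diff_id x))).
Qed.

(** * Congruences of bilinear forms *)

(** Congruence of the hypothesis by [T1] turns its left side into [J] and its right side into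
    [S^T J S], since [T2^-1 T1 = S]. *)
Lemma mx_form_inv_eq (F : comUnitRingType) (m : nat) (T1 T2 S J : 'M[F]_m) :
  T1 \in unitmx -> T2 \in unitmx -> T1 = T2 *m S ->
  (invmx T1)^T *m J *m invmx T1 = (invmx T2)^T *m J *m invmx T2 ->
  S^T *m J *m S = J.
Proof.
move=> u1 u2 TE H; have -> : S = invmx T2 *m T1 by rewrite TE mulKmx.
rewrite trmx_mul !mulmxA -2!(mulmxA T1^T) -H -!mulmxA mulVmx// mulmx1.
by rewrite mulmxA -trmx_mul mulVmx// trmx1 mul1mx.
Qed.

(** The matrix [S] of [D] in the bases [E], [E'] satisfies [E' S = D E], so [D^T W' D] and [W] both
    become [J] under congruence by the invertible [E]. *)
Lemma mx_form_frame (F : comUnitRingType) (m : nat)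
    (D E E' W W' J : 'M[F]_m) :
  E \in unitmx -> E' \in unitmx ->
  E^T *m W *m E = J -> E'^T *m W' *m E' = J ->
  (invmx E' *m D *m E)^T *m J *m (invmx E' *m D *m E) = J ->
  D^T *m W' *m D = W.
Proof.
move=> uE uE' WJ W'J; set S := _ *m E => SJ.
have DE : E' *m S = D *m E by rewrite /S !mulmxA mulmxV// mul1mx.
have DEJ : (D *m E)^T *m W' *m (D *m E) = J.
  by rewrite -DE trmx_mul -[RHS]SJ -W'J !mulmxA.
have uEt : E^T \in unitmx by rewrite unitmx_tr.
apply: (can_inj (mulmxK uE)); apply: (can_inj (mulKmx uEt)).
by rewrite !mulmxA WJ -DEJ trmx_mul !mulmxA.
Qed.

(** * Tangent maps read in charts *)

Section CoordTangent.
Variables (R : realType) (d : nat) (M : topologicalType).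
Implicit Types (c : chart R d M) (f g : M -> M) (z : M).

Lemma near_cinv c z (P : set M) :
  cdom c z -> (\forall w \near z, P w) -> \forall x \near c z, P (cinv c x).
Proof.
move=> cz; have : cinv c x @[x --> c z] --> z.
  by rewrite -{2}(cmapK cz); apply: cinv_continuous; exists z.
exact.
Qed.

Lemma near_eq_coord_tangent c c' f g z : cdom c z ->
  (\forall w \near z, f w = g w) ->
  differentiable (c' \o g \o cinv c) (c z) ->
  differentiable (c' \o f \o cinv c) (c z)
  /\ coord_tangent c c' f z = coord_tangent c c' g z.
Proof.
move=> cz fg dg.
have fg' : \forall x \near c z,
    (c' \o f \o cinv c) x = (c' \o g \o cinv c) x.
  by have := near_cinv cz fg; apply: filterS => x /= ->.
have [df dE] := near_eq_jacobian fg' dg; split; first exact: df.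
by rewrite /coord_tangent dE.
Qed.

(** Composing the two coordinate expressions inserts [cinv c' \o c'], the identity only on
    [cdom c']. Continuity of [g] keeps [g w] there for [w] near [z], so the chain rule applies
    locally. *)
Lemma coord_tangent_comp c c' c'' f g z : cdom c z -> cdom c' (g z) ->
  {for z, continuous g} ->
  differentiable (c' \o g \o cinv c) (c z) ->
  differentiable (c'' \o f \o cinv c') (c' (g z)) ->
  differentiable (c'' \o (f \o g) \o cinv c) (c z)
  /\ coord_tangent c c'' (f \o g) z
     = coord_tangent c' c'' f (g z) *m coord_tangent c c' g z.
Proof.
move=> cz cgz cg dg df.
have nE : \forall x \near c z, (c'' \o (f \o g) \o cinv c) x
    = ((c'' \o f \o cinv c') \o (c' \o g \o cinv c)) x.
  have : \forall w \near z, cdom c' (g w).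
    by apply: cg; apply: open_nbhs_nbhs; split => //; exact: cdom_open.
  by move=> /(near_cinv cz); apply: filterS => x /= cgx; rewrite cmapK.
have gzE : (c' \o g \o cinv c) (c z) = c' (g z) by rewrite /= cmapK.
rewrite -gzE in df.
have [dfg dE] := near_eq_jacobian nE (differentiable_comp dg df).
split; first exact: dfg.
by rewrite /coord_tangent -trmx_mul dE (jacobian_comp dg df) gzE.
Qed.

Lemma coord_tangent_id c z : cdom c z ->
  differentiable (c \o idfun \o cinv c) (c z)
  /\ coord_tangent c c idfun z = 1%:M.
Proof.
move=> cz.
have nE : \forall x \near c z, (c \o idfun \o cinv c) x = idfun x.
  have : nbhs (c z) (c @` cdom c).
    by apply: open_nbhs_nbhs; split; [exact: cimg_open | exists z].
  by apply: filterS => _ [w cw <-] /=; rewrite cmapK.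
have [df dE] := near_eq_jacobian nE (ex_diff (is_diff_def := is_diff_id (c z))).
split; first exact: df.
by rewrite /coord_tangent dE jacobian_id trmx1.
Qed.

End CoordTangent.

(** * Pullback of the form, local diffeomorphisms and symplectic frames *)

Section SymplecticManifold.
Variables (R : realType) (n : nat) (M : symplectic_manifold R n).
Implicit Types (U V : set M) (f g : M -> M) (c : chart R (n + n) M) (z : M).

Lemma smooth_on_diff V f c c' z : smooth_on V f -> atlas c -> atlas c' ->
  V z -> cdom c z -> cdom c' (f z) ->
  differentiable (c' \o f \o cinv c) (c z).
Proof.
move=> [_ sf] ac ac' Vz cz cfz.
by have [+ _] := sf c c' ac ac' 1; apply; exists z.
Qed.

Lemma compatible_diff c c' z : atlas c -> atlas c' -> cdom c z -> cdom c' z ->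
  differentiable (c' \o idfun \o cinv c) (c z).
Proof.
move=> ac ac' cz c'z; have [s _] := atlas_compatible ac ac'.
by have [+ _] := s 1; apply; exists z.
Qed.

(** Reduces [symplectic_on], which ranges over all charts, to one pair of charts: the tangent matrix
    changes by transition matrices on both sides, which [omega_change] absorbs. *)
Lemma pullback_omega_charts f z c c' c0 c0' :
  atlas c -> atlas c' -> atlas c0 -> atlas c0' ->
  cdom c z -> cdom c' (f z) -> cdom c0 z -> cdom c0' (f z) ->
  {for z, continuous f} -> differentiable (c' \o f \o cinv c) (c z) ->
  (coord_tangent c c' f z)^T *m omega c' (c' (f z)) *m coord_tangent c c' f z
    = omega c (c z) ->
  (coord_tangent c0 c0' f z)^T *m omega c0' (c0' (f z))
    *m coord_tangent c0 c0' f z = omega c0 (c0 z).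
Proof.
move=> ac ac' ac0 ac0' cz cfz c0z c0fz cf df fom.
have cid : {for z, continuous (@idfun M)} by exact: cvg_id.
have [d1 E1] := coord_tangent_comp cz cfz cf df
  (compatible_diff ac' ac0' cfz c0fz).
(* Here [f] is read as [(idfun \o f) \o idfun], the inner identity being the transition from [c0] to
   [c]. *)
have [_ E2] := @coord_tangent_comp _ _ _ c0 c c0' (idfun \o f) idfun z
  c0z cz cid (compatible_diff ac0 ac c0z cz) d1.
have {E1 E2} E : coord_tangent c0 c0' f z = coord_tangent c' c0' idfun (f z)
    *m coord_tangent c c' f z *m coord_tangent c0 c idfun z.
  by rewrite -E1; exact: E2.
rewrite -(omega_change ac0 ac c0z cz) -fom -(omega_change ac' ac0' cfz c0fz) E.
move: (coord_tangent c' c0' _ _) (coord_tangent c c' _ _) => A B.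
move: (coord_tangent c0 c _ _) (omega c0' _) => C W.
by rewrite !trmx_mul !mulmxA.
Qed.

(** The chain rule for [g \o f = id] near [z] gives a left inverse, which suffices for a square
    matrix. *)
Lemma local_diffeo_unitmx U f c z : local_diffeo U f -> atlas c ->
  U `<=` cdom c -> U z -> coord_tangent c c f z \in unitmx.
Proof.
move=> [fU fl] ac Uc Uz.
have [V [g [[oV Vz VU] [ofV sf sg gK]]]] := fl z Uz.
have cfz : cdom c (f z) by apply/Uc/fU.
have df := smooth_on_diff sf ac ac Vz (Uc _ Uz) cfz.
have dg : differentiable (c \o g \o cinv c) (c (f z)).
  by apply: (smooth_on_diff sg) => //; rewrite gK//; exact: Uc.
have [_ E] := coord_tangent_comp (Uc _ Uz) cfz (sf.1 z Vz) df dg.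
have gf : \forall w \near z, (g \o f) w = idfun w.
  by apply: filterS (open_nbhs_nbhs (conj oV Vz)) => w /gK.
have [did Eid] := coord_tangent_id (Uc _ Uz).
have [_ E'] := near_eq_coord_tangent (Uc _ Uz) gf did.
by move: E; rewrite E' Eid => /esym/mulmx1_unit[].
Qed.

Lemma local_diffeo_continuous U f z : local_diffeo U f -> U z ->
  {for z, continuous f}.
Proof.
by move=> [_ fl] /[dup] Uz /fl[V [g [[_ Vz _] [_ [+ _] _ _]]]]; apply.
Qed.

Lemma local_diffeo_diff U f c z : local_diffeo U f -> atlas c ->
  U `<=` cdom c -> U z -> differentiable (c \o f \o cinv c) (c z).
Proof.
move=> [fU fl] ac Uc Uz; have [V [g [[_ Vz _] [_ sf _ _]]]] := fl z Uz.
by apply: (smooth_on_diff sf) => //; apply: Uc => //; exact: fU.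
Qed.

(* A continuous lift of a local diffeomorphism through another one is
   differentiable, being locally [g \o p] with [g] a smooth local inverse. *)
Lemma local_diffeo_lift U p q h c z : open U ->
  local_diffeo U p -> local_diffeo U q ->
  atlas c -> U `<=` cdom c -> U z -> U (h z) -> {for z, continuous h} ->
  (forall w, U w -> q (h w) = p w) ->
  differentiable (c \o h \o cinv c) (c z)
  /\ coord_tangent c c q (h z) *m coord_tangent c c h z
     = coord_tangent c c p z.
Proof.
move=> oU lp lq ac Uc Uz Uhz ch qh.
have [V [g [[oV Vhz VU] [ofV sq sg gK]]]] := lq.2 _ Uhz.
have hV : \forall w \near z, V (h w).
  by apply: ch; exact: open_nbhs_nbhs.
have zU : \forall w \near z, U w by exact: open_nbhs_nbhs.
have hE : \forall w \near z, h w = (g \o p) w.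
  by near=> w; rewrite /= -qh ?gK//; near: w.
have Upz : U (p z) by exact: lp.1.
have dg : differentiable (c \o g \o cinv c) (c (p z)).
  apply: (smooth_on_diff sg) => //; [by rewrite -qh//; exists (h z)|exact: Uc|].
  by rewrite -qh// gK//; exact: Uc.
have dp := local_diffeo_diff lp ac Uc Uz.
have cp := local_diffeo_continuous lp Uz.
have [dgp _] := coord_tangent_comp (Uc _ Uz) (Uc _ Upz) cp dp dg.
have [dh _] := near_eq_coord_tangent (Uc _ Uz) hE dgp; split; first exact: dh.
have dq := local_diffeo_diff lq ac Uc Uhz.
have [_ <-] := coord_tangent_comp (Uc _ Uz) (Uc _ Uhz) ch dh dq.
have qhp : \forall w \near z, (q \o h) w = p w.
  by apply: filterS zU => w /qh.
by have [_ ->] := near_eq_coord_tangent (Uc _ Uz) qhp dp.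
Unshelve. all: by end_near. Qed.

(** Condition (1) is read from right to left, with consistency point [psi1 K z]. *)
Lemma consistency_map_step U phi (K : consistency U phi) z : U z ->
  implicit_step U phi z (consistency_map K z).
Proof.
move=> Uz; have pz : (psi1 K @` U) (psi1 K z) by exists z.
have Uz' : U (consistency_map K z) := psi2V_fun pz.
split => //; apply/(consistency_point K Uz Uz').
exists (psi1 K z); first exact: (psi1_local_diffeo K).1.
by split => //; rewrite /consistency_map /= psi2VK.
Qed.

Lemma consistency_map_continuous U phi (K : consistency U phi) z : U z ->
  {for z, continuous (consistency_map K)}.
Proof.
move=> Uz; apply: continuous_comp.
  exact: local_diffeo_continuous (psi1_local_diffeo K) Uz.
by apply: psi2V_continuous; exists z.
Qed.

(** Since [J^2 = -1], the inverse is [-J]. *)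
Lemma Jmx_unitmx : Jmx R n \in unitmx.
Proof.
suff /mulmx1_unit[] : Jmx R n *m - Jmx R n = 1%:M by [].
rewrite mulmxN /Jmx mulmx_block !mul0mx !mulmx0 !mulmx1 mul1mx !add0r !addr0.
by rewrite opp_block_mx opprK oppr0 -scalar_mx_block.
Qed.

Lemma trmx_Jmx : (Jmx R n)^T = - Jmx R n.
Proof.
by rewrite /Jmx tr_block_mx opp_block_mx linearN /= !trmx0 !trmx1 opprK oppr0.
Qed.

Lemma symplectic_frame_unitmx c U (e : M -> 'M[R]_(n + n)) z :
  symplectic_frame c U e -> U z -> e z \in unitmx.
Proof.
move=> he /he E; have : (Jmx R n)^T \in unitmx by rewrite unitmx_tr Jmx_unitmx.
by rewrite -E unitmx_mul => /andP[].
Qed.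

(** Undoing the frame recovers [omega]; the sign comes from [J^T = -J]. *)
Lemma symplectic_frame_omega c U (e : M -> 'M[R]_(n + n)) z :
  symplectic_frame c U e -> U z ->
  (invmx (e z))^T *m Jmx R n *m invmx (e z) = - omega c (c z).
Proof.
move=> he Uz; have ue := symplectic_frame_unitmx he Uz.
have uet : (e z)^T \in unitmx by rewrite unitmx_tr.
apply: oppr_inj; rewrite opprK -mulNmx -mulmxN -trmx_Jmx -(he z Uz).
by rewrite trmx_inv !mulmxA mulVmx// mul1mx -mulmxA mulmxV// mulmx1.
Qed.

End SymplecticManifold.

Theorem lemma3p3 (R : realType) (n : nat) (M : symplectic_manifold R n)
    (U : set M) (c : chart R (n + n) M) (e : M -> 'M[R]_(n + n))
    (phi : M * M -> M) (K : consistency U phi)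
    (Uopen : open U) (atlas_c : atlas c) (Uc : U `<=` cdom c)
    (Uconvex : @convex_set R 'rV[R]_(n + n) (c @` U))
    (eframe : symplectic_frame c U e)
    (phiU : set_fun (U `*` U) U phi) :
  let T1 := tangent_mx c e (psi1 K) in
  let T2 := tangent_mx c e (psi2 K) in
  let J := Jmx R n in
  ((forall z z', implicit_step U phi z z' ->
      (invmx (T1 z))^T *m J *m invmx (T1 z)
      = (invmx (T2 z'))^T *m J *m invmx (T2 z')) ->
   interleaves_symplectic_map K)
  /\
  (symplectic_on U (psi1 K) -> symplectic_on U (psi2 K) ->
   forall z z', implicit_step U phi z z' ->
     (T1 z)^T *m J *m T1 z = (T2 z')^T *m J *m T2 z').
Proof.
move=> T1 T2 J; have l1 := psi1_local_diffeo K; have l2 := psi2_local_diffeo K.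
split.
- move=> H z c0 c0' Uz ac0 ac0' c0z c0fz.
  set z' := consistency_map K z.
  have step : implicit_step U phi z z' := consistency_map_step K Uz.
  have [_ Uz' _] := step.
  have p2 w : U w -> psi2 K (consistency_map K w) = psi1 K w.
    by move=> Uw; apply: psi2VK; exists w.
  have ch : {for z, continuous (consistency_map K)}.
    exact: consistency_map_continuous.
  have [dh hE] := local_diffeo_lift (h := consistency_map K) Uopen l1 l2
    atlas_c Uc Uz Uz' ch p2.
  (* It is enough to compute in the single chart [c]. *)
  apply: (pullback_omega_charts (f := consistency_map K) atlas_c atlas_c ac0
    ac0' (Uc _ Uz) (Uc _ Uz') c0z c0fz ch dh).
  have Ub : U (psi1 K z) by exact: l1.1.
  have ue := symplectic_frame_unitmx eframe Uz.
  have ue' := symplectic_frame_unitmx eframe Uz'.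
  have ueb := symplectic_frame_unitmx eframe Ub.
  have uA := local_diffeo_unitmx l1 atlas_c Uc Uz.
  have uB := local_diffeo_unitmx l2 atlas_c Uc Uz'.
  (* In the frames at [z] and [z'], the goal is that the tangent matrix of the consistency map
     preserves [J^T], hence [J]. *)
  apply: (mx_form_frame ue ue' (eframe _ Uz) (eframe _ Uz')).
  rewrite trmx_Jmx mulmxN mulNmx; congr (- _).
  apply: (mx_form_inv_eq _ _ _ (H _ _ step)).
  - by rewrite !unitmx_mul unitmx_inv ueb uA ue.
  - by rewrite !unitmx_mul unitmx_inv (p2 z Uz) ueb uB ue'.
  (* Both tangent maps land at the same consistency point, so they share its frame, while the frame
     at [z'] cancels in the product. *)
  - rewrite /T1 /T2 /tangent_mx (p2 z Uz) -hE !mulmxA.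
    by rewrite mulmxK.
- move=> s1 s2 z z' step.
  (* Each side equals [J] separately: the frame at [f w] turns [J] into [-omega], the pullback by
     [f] moves this to [w], and the frame at [w] gives [-J^T = J]. *)
  suff preJ f w : U w -> U (f w) -> symplectic_on U f ->
      (tangent_mx c e f w)^T *m J *m tangent_mx c e f w = J.
    have [Uz Uz' _] := step.
    by rewrite !preJ//; [exact: l2.1|exact: l1.1].
  move=> Uw Ufw sf; rewrite /tangent_mx !trmx_mul !mulmxA.
  rewrite -(mulmxA _ _ J) -(mulmxA _ _ (invmx (e (f w)))).
  rewrite (symplectic_frame_omega eframe Ufw) !(mulmxN, mulNmx).
  rewrite -(mulmxA _ _ (omega _ _)) -(mulmxA _ _ (coord_tangent _ _ _ _)).
  rewrite (sf w c c Uw atlas_c atlas_c (Uc _ Uw) (Uc _ Ufw)) (eframe w Uw).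
  by rewrite trmx_Jmx opprK.
Qed.
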